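(* Let $G$ be a finite abelian group and $S$ a nonempty zero-sum free sequence over $G$. Then $|\Sigma(S)| = |S|+|\mathrm{supp}(S)|-1$ if and only if $S$ is of one of the following forms: (1) $S=g^{|S|}$ for some $g\in G\setminus\{0\}$ with $\mathrm{ord}(g)\geq |S|+1$; (2) $S=g_1\cdot g_2$ for some $g_1, g_2\in G\setminus\{0\}$ with $g_1\neq g_2$; (3) $S=g^{|S|-1}\cdot(2g)$ for some $g\in G\setminus\{0\}$, with $|S|\geq 3$ and $\mathrm{ord}(g)\geq |S|+2$; (4) $S=g_1\cdot g_2 \cdot (g_1+g_2)$ for some $g_1, g_2\in G\setminus\{0\}$ with $2g_1\neq 0$, $2g_2= 0$ and $2g_1+g_2\neq 0$.
   Context: $G$ is written additively. A sequence over $G$ is a finite unordered sequence (multiset) of elements of $G$, repetition allowed, written multiplicatively as an element of the free abelian monoid with basis $G$: $S=g_1\cdot\ldots\cdot g_\ell=\prod_{g\in G} g^{\mathsf v_g(S)}$, where $\mathsf v_g(S)\ge 0$ is the multiplicity of $g$ in $S$. So $g^{m}$ denotes the sequence consisting of $g$ repeated $m$ times, and $(2g)$, $(g_1+g_2)$ denote single terms equal to the group elements $2g$, $g_1+g_2$. $|S|=\ell$ is the length of $S$ (counted with multiplicity), $\mathrm{supp}(S)=\{g\in G: \mathsf v_g(S)>0\}$ is the set of distinct terms, and $\sigma(S)=g_1+\cdots+g_\ell\in G$ is the sum. A subsequence $T$ of $S$ is a sequence with $\mathsf v_g(T)\le \mathsf v_g(S)$ for all $g\in G$. $\Sigma(S)=\{\sigma(T):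 T \text{ is a subsequence of } S \text{ with } 1\le |T|\le |S|\}\subset G$. $S$ is zero-sum free if $0\notin\Sigma(S)$. $\mathrm{ord}(g)$ is the order of $g$ in $G$. *)

(* Defs.v *)
From mathcomp Require Export all_boot all_algebra all_fingroup.
From mathcomp Require Export finmap multiset.
From mathcomp Require Import boolp.

Set Implicit Arguments.
Unset Strict Implicit.
Unset Printing Implicit Defensive.

Import GRing.Theory.

Local Open Scope ring_scope.
Local Open Scope mset_scope.

Section Sequences.
Variable G : finZmodType.
Implicit Types S T : {mset G}.

(* Terms are summed with multiplicity: the coercion of a multiset to seq
   lists each element as often as it occurs. *)
Definition msum S : G := \sum_(g <- S) g.

Definition subsums S : {set G} :=
  [set x | `[< exists T : {mset G},
                [/\ T `<=` S, (1 <= size T <= size S)%N & msum T = x] >]].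

Definition zero_sum_free S : bool := 0 \notin subsums S.

End Sequences.

(* Main.v *)
(* Let B(S) be the set of all subset sums of S, the empty one included, so that
   the claim is about the equality case of |B(S)| >= |S| + |supp S|.  The key
   fact is that at most one x in supp S satisfies |B(S)| = |B(S x^-1)| + 1: for
   such an x, B(S) is stable under adding x except at the full sum s, hence, by
   the symmetry b |-> s - b, stable under subtracting x except at 0.  If x and z
   are two such elements, then z, z - x and -x lie in B(S); but -x is not in
   B(S x^-1), which is B(S) without s, so s = -x; likewise s = -z and x = z.
   Removing an element which contributes at least 2 gives the lower bound by
   induction.  In the equality case that element occurs exactly once and
   contributes exactly 2, and S x^-1 is again extremal; it then remains to see
   which of the four forms can be extended by such an x. *)
Require Import Defs.
From mathcomp Require Import all_solvable boolp zify.

Set Implicit Arguments.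
Unset Strict Implicit.
Unset Printing Implicit Defensive.

Import GRing.Theory FinRing.Theory.

Local Open Scope ring_scope.
Local Open Scope mset_scope.

(** * Length, support and weight of multisets *)

Section Multisets.
Variable K : choiceType.
Implicit Types (x : K) (S T : {mset K}).

Lemma perm_msetD S T : perm_eq (S `+` T) (S ++ T).
Proof. by apply/allP=> a _ /=; rewrite count_cat !count_mem_mset msetE2. Qed.

Lemma size_msetD S T : size (S `+` T) = (size S + size T)%N.
Proof. by rewrite (perm_size (perm_msetD S T)) size_cat. Qed.

Lemma size_msetn n x : size (msetn n x) = n.
Proof. by rewrite enum_msetn size_nseq. Qed.

Lemma size_mset1D x S : size (x +` S) = (size S).+1.
Proof. by rewrite size_msetD size_msetn. Qed.

Lemma size_mset_eq0 S : (size S == 0%N) = (S == mset0).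
Proof.
apply/idP/eqP => [/nilP S0|->]; last by rewrite enum_mset0.
by apply/msetP=> a; rewrite -count_mem_mset S0 mset0E.
Qed.

Lemma mset_neq0P S : S != mset0 -> exists x, x \in S.
Proof.
rewrite -size_mset_eq0 => S0.
have : exists x, x \in (S : seq K).
  by case: (S : seq K) S0 => // x s _; exists x; rewrite mem_head.
by [].
Qed.

Lemma msetn_or_distinct S : S != mset0 ->
  (exists g, S = msetn (size S) g) \/
  (exists x z, [/\ x \in S, z \in S & x != z]).
Proof.
move=> /mset_neq0P [g gS]; have [/all_pred1P Sg|/allPn [z zS zg]] := boolP (all (pred1 g) S).
  by left; exists g; rewrite -[LHS]seq_mset_id Sg -enum_msetn seq_mset_id size_msetn.
by right; exists z, g.
Qed.

Lemma card_finsupp_mset1D x S :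
  #|` finsupp (x +` S)| = ((x \notin S) + #|` finsupp S|)%N.
Proof.
rewrite -(msuppE x S) -cardfsU1; congr #|` _|.
by apply/fsetP=> a; rewrite !inE !msuppE in_mset1D.
Qed.

(** Counting the empty sum in B(S) absorbs the [- 1] of the theorem, so that this is the extremal
    value of |B(S)|. *)
Definition weight S := (size S + #|` finsupp S|)%N.

Lemma weight0 : weight mset0 = 0%N.
Proof. by rewrite /weight enum_mset0 finsupp0 cardfs0. Qed.

Lemma weight_mset1D x S : weight (x +` S) = (weight S + (x \notin S).+1)%N.
Proof. by rewrite /weight size_mset1D card_finsupp_mset1D addSn addnCA addnS addnC. Qed.

Lemma weight_msetn n x : (0 < n)%N -> weight (msetn n x) = n.+1.
Proof. by move=> n0; rewrite /weight size_msetn finsupp_msetn n0 cardfs1 addn1. Qed.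

End Multisets.

(** * Subset sums and how they change when a term is adjoined *)

Section SubsetSums.
Variable G : finZmodType.
Implicit Types (g x y z s : G) (S T : {mset G}) (A : {set G}).

Lemma msum0 : msum (mset0 : {mset G}) = 0.
Proof. by rewrite /msum big_mset0. Qed.

Lemma msumD S T : msum (S `+` T) = msum S + msum T.
Proof. by rewrite /msum (perm_big _ (perm_msetD S T)) big_cat. Qed.

Lemma msum1 x : msum [mset x] = x.
Proof. by rewrite /msum enum_msetn big_seq1. Qed.

(** Admitting the empty subsequence makes the set symmetric under b |-> [msum S] - b and gives the
    recursion B(x S) = B(S) ∪ (x + B(S)). *)
Definition subsums0 S : {set G} :=
  [set x | `[< exists2 T, T `<=` S & msum T = x >]].

(* Elaboration reaches the carrier of [G] along several coercion paths; naming
   the cardinal gives [lia] a single atom. *)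
Definition nsums S : nat := #|subsums0 S|.

Lemma subsums0P S x :
  reflect (exists2 T, T `<=` S & msum T = x) (x \in subsums0 S).
Proof. by rewrite inE; apply: asboolP. Qed.

Lemma zero_sum_freeP S :
  reflect (forall T, T `<=` S -> msum T = 0 -> T = mset0) (zero_sum_free S).
Proof.
apply: (iffP idP) => [zS T TS T0|zS].
  apply/eqP; apply: contraNT zS => Tn0; rewrite inE; apply/asboolP.
  exists T; split=> //; rewrite lt0n size_mset_eq0 Tn0 /=.
  by rewrite -(msetBDKC TS) size_msetD leq_addr.
rewrite /zero_sum_free inE; apply/asboolP => -[T [TS /andP [T0 _] /(zS _ TS) T00]].
by rewrite lt0n size_mset_eq0 T00 eqxx in T0.
Qed.

Lemma subsums0E S : subsums0 S = 0 |: subsums S.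
Proof.
apply/setP=> y; rewrite in_setU1; apply/subsums0P/predU1P => [[T TS <-]|[->|]].
- have [->|T0] := eqVneq T mset0; first by rewrite msum0; left.
  right; rewrite inE; apply/asboolP; exists T; split=> //.
  by rewrite lt0n size_mset_eq0 T0 /= -(msetBDKC TS) size_msetD leq_addr.
- by exists mset0; rewrite ?msub0set ?msum0.
- by rewrite inE => /asboolP [T [TS _ <-]]; exists T.
Qed.

Lemma card_subsums0 S : zero_sum_free S -> nsums S = #|subsums S|.+1.
Proof. by rewrite /zero_sum_free /nsums subsums0E cardsU1 => ->. Qed.

Lemma mem0_subsums0 S : 0 \in subsums0 S.
Proof. by rewrite subsums0E setU11. Qed.

Lemma subsums0_mset0 : subsums0 mset0 = [set 0].
Proof.
apply/setP=> y; rewrite !inE; apply/asboolP/eqP => [[T]|->].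
  by rewrite msubset0 => /eqP -> <-; rewrite msum0.
by exists mset0; rewrite ?msub0set ?msum0.
Qed.

Lemma mem_msum_subsums0 S : msum S \in subsums0 S.
Proof. by apply/subsums0P; exists S; rewrite ?msubset_refl. Qed.

Lemma subsums0_sym S y : y \in subsums0 S -> msum S - y \in subsums0 S.
Proof.
case/subsums0P=> T TS <-; apply/subsums0P; exists (S `\` T); rewrite ?msubsetDl//.
by rewrite -{2}(msetBDKC TS) msumD addrC addKr.
Qed.

Lemma msubset_mset1D x S T :
  T `<=` x +` S -> T `<=` S \/ exists2 U, U `<=` S & T = x +` U.
Proof.
move=> TS; have [xT|xT] := boolP (x \in T).
  right; exists (T `\ x); last by rewrite msetB1K.
  by rewrite subset_msetBLR.
left; apply/msubsetP=> a; have /msubsetP/(_ a) := TS.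
by rewrite mset1DE; case: eqP => // ->; rewrite (mset_eq0P xT).
Qed.

Lemma in_subsums0_mset1D x S y :
  (y \in subsums0 (x +` S)) = (y \in subsums0 S) || (y - x \in subsums0 S).
Proof.
apply/subsums0P/orP => [[T /msubset_mset1D [TS|[U US ->]] <-]|].
- by left; apply/subsums0P; exists T.
- by right; apply/subsums0P; exists U; rewrite // msumD msum1 addrC addKr.
case=> /subsums0P [T TS Ty].
  by exists T => //; apply: (msubset_trans TS); rewrite -{1}(mset0D S) msetSD ?msub0set.
by exists (x +` T); rewrite ?msetDS // msumD msum1 Ty addrC subrK.
Qed.

Lemma zero_sum_free_mset1D x S :
  zero_sum_free (x +` S) = zero_sum_free S && (- x \notin subsums0 S).
Proof.
apply/zero_sum_freeP/andP => [zS|[/zero_sum_freeP zS xS] T].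
  have sub T : T `<=` S -> T `<=` x +` S.
    by move=> TS; apply: (msubset_trans TS); rewrite -{1}(mset0D S) msetSD ?msub0set.
  split; first by apply/zero_sum_freeP=> T /sub; apply: zS.
  apply/negP=> /subsums0P [T TS Tx].
  have : x +` T = mset0 by apply: (zS _ (msetDS _ TS)); rewrite msumD msum1 Tx addrN.
  by move/eqP; rewrite -size_mset_eq0 size_mset1D.
case/msubset_mset1D=> [|[U US ->]]; first exact: zS.
rewrite msumD msum1 => /eqP; rewrite addrC addr_eq0 => /eqP Ux.
by case/negP: xS; apply/subsums0P; exists U.
Qed.

Lemma subsums0_mset1D_sub x S : subsums0 S \subset subsums0 (x +` S).
Proof. by apply/subsetP=> y yS; rewrite in_subsums0_mset1D yS. Qed.

(** Were the full sum of x S in B(S), its mirror image in B(S) would be -x, and x would complete a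
    zero sum. *)
Lemma msum_notin_subsums0 x S :
  zero_sum_free (x +` S) -> msum (x +` S) \notin subsums0 S.
Proof.
rewrite zero_sum_free_mset1D => /andP [_]; apply: contra => /subsums0_sym.
by rewrite msumD msum1 opprD addrCA addrN addr0.
Qed.

Lemma card_subsums0_mset1D x S :
  zero_sum_free (x +` S) -> (nsums S < nsums (x +` S))%N.
Proof.
move=> zS; apply/proper_card/properP; split; first exact: subsums0_mset1D_sub.
by exists (msum (x +` S)); [apply: mem_msum_subsums0 | apply: msum_notin_subsums0].
Qed.

(** * The number of sums gained from one term, and the lower bound *)

Lemma card_subsums0_uniq x S (s : seq G) :
    uniq s -> {in s, forall y, (y \notin subsums0 S) && (y - x \in subsums0 S)} ->
  (nsums S + size s <= nsums (x +` S))%N.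
Proof.
move=> us ns; rewrite /nsums -(cardsID (subsums0 S) (subsums0 (x +` S))).
rewrite (setIidPr (subsums0_mset1D_sub x S)) leq_add2l -(card_uniqP us).
apply/subset_leq_card/subsetP=> y /ns /andP [yS yxS].
by rewrite inE yS in_subsums0_mset1D yxS orbT.
Qed.

(** The full sum is always new, so a gain of one leaves room for nothing else. *)
Lemma subsums0_gain1 x S :
    zero_sum_free (x +` S) -> (nsums (x +` S) <= (nsums S).+1)%N ->
  subsums0 (x +` S) = msum (x +` S) |: subsums0 S.
Proof.
move=> zS leS; apply/esym/eqP.
rewrite eqEcard subUset sub1set mem_msum_subsums0 subsums0_mset1D_sub.
by rewrite cardsU1 msum_notin_subsums0.
Qed.

(** [A] plays the role of B(S) and [s] that of its full sum; stated abstractly, the argument is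
    symmetric in [x] and [z]. *)
Lemma two_steps_false A s x z :
    s != 0 -> x != z -> x != 0 -> z != 0 -> 0 \in A ->
    (forall b, b \in A -> s - b \in A) ->
    (forall b, b \in A -> b != s -> x + b \in A) ->
    (forall b, b \in A -> b != s -> z + b \in A) ->
    (- x \in A -> s = - x) -> (- z \in A -> s = - z) ->
  False.
Proof.
move=> s0 xz x0 z0 A0 symA stepx stepz Nx Nz.
(* Reflect, step forward and reflect again: s - (y + (s - b)) = b - y. *)
have back y : (forall b, b \in A -> b != s -> y + b \in A) ->
    forall b, b \in A -> b != 0 -> b - y \in A.
  move=> stepy b bA b0.
  have /symA : y + (s - b) \in A.
    by rewrite stepy ?symA // -subr_eq0 addrAC addrN sub0r oppr_eq0.
  by rewrite addrCA opprD addNKr opprB.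
have backx := back x stepx; have {back} backz := back z stepz.
have xA : x \in A by rewrite -[x]addr0 stepx // eq_sym.
have zA : z \in A by rewrite -[z]addr0 stepz // eq_sym.
(* Walk back from z to z - x and then to -x; the second step is allowed because z - x is nonzero. *)
have nxA : - x \in A by rewrite -(addrK z (- x)) (addrC _ z) backz ?backx // subr_eq0 eq_sym.
have nzA : - z \in A by rewrite -(addrK x (- z)) (addrC _ x) backx ?backz // subr_eq0.
by case/eqP: xz; apply: oppr_inj; rewrite -(Nx nxA) (Nz nzA).
Qed.

Lemma exists_gain2 S x z :
    zero_sum_free S -> x \in S -> z \in S -> x != z ->
  exists y T, S = y +` T /\ (nsums T + 2 <= nsums S)%N.
Proof.
move=> zS xS zS' xz.
have s0 : msum S != 0.
  apply: contraTneq (mem0_subsums0 (S `\ x)) => <-.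
  by rewrite -{1}(msetB1K xS) msum_notin_subsums0 // msetB1K.
(* A term contributing only one sum satisfies all the hypotheses of [two_steps_false]: every b other
   than the full sum already lies in B(T), so y + b lies in B(y T). *)
have gain y : y \in S -> ~~ (nsums (S `\ y) + 2 <= nsums S)%N ->
    [/\ y != 0, forall b, b \in subsums0 S -> b != msum S -> y + b \in subsums0 S
      & - y \in subsums0 S -> msum S = - y].
  move=> yS; rewrite -ltnNge addn2 ltnS.
  move: zS; rewrite -(msetB1K yS); move: (S `\ y) => T; rewrite msetD1K => zT leT.
  have /andP[_ yT] : zero_sum_free T && (- y \notin subsums0 T).
    by rewrite -zero_sum_free_mset1D.
  split; first by apply: contraNneq yT => ->; rewrite oppr0 mem0_subsums0.
    move=> b; rewrite {1}subsums0_gain1 // in_setU1 => /predU1P[->|bT _].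
      by rewrite eqxx.
    by rewrite in_subsums0_mset1D addrC addrK bT orbT.
  by rewrite {1}subsums0_gain1 // in_setU1 (negPf yT) orbF => /eqP.
have [g2|/(gain _ xS) [x0 stepx Nx]] := boolP (nsums (S `\ x) + 2 <= nsums S)%N.
  by exists x, (S `\ x); rewrite msetB1K.
have [g2|/(gain _ zS') [z0 stepz Nz]] := boolP (nsums (S `\ z) + 2 <= nsums S)%N.
  by exists z, (S `\ z); rewrite msetB1K.
exfalso; apply: (two_steps_false s0 xz x0 z0 (mem0_subsums0 S) _ stepx stepz Nx Nz).
by move=> b; apply: subsums0_sym.
Qed.


Lemma weight_leq_subsums0 S :
  zero_sum_free S -> (weight S <= nsums S)%N.
Proof.
elim: {S}(size S) {-2}S (erefl (size S)) => [|n IHn] S szS zS.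
  by move/eqP: szS; rewrite size_mset_eq0 => /eqP ->; rewrite weight0.
have [x xS] : exists x, x \in S by apply: mset_neq0P; rewrite -size_mset_eq0 szS.
have bound y T : S = y +` T -> [/\ weight S = (weight T + (y \notin T).+1)%N
    & (weight T <= nsums T)%N].
  move=> ST; move: szS zS; rewrite ST size_mset1D weight_mset1D => -[szT].
  by rewrite zero_sum_free_mset1D => /andP[/(IHn _ szT)].
(* With two distinct terms, a gain of 2 covers the weight of the removed term, which is at most
   2. *)
have [[z zS' xz]|xE] := pselect (exists2 z, z \in S & x != z).
  have [y [T [/bound [-> leT] leS]]] := exists_gain2 zS xS zS' xz.
  by case: (y \notin T) => /=; lia.
have {}xE z : z \in S -> x = z.
  by move=> zS'; apply/eqP/negPn/negP => xz; apply: xE; exists z.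
have SE := msetB1K xS.
have [wS leT] := bound _ _ (esym SE).
have ltS : (nsums (S `\ x) < nsums S)%N.
  by rewrite -{2}SE card_subsums0_mset1D // SE.
(* A repeated x adds weight 1, and strict growth of B suffices; otherwise S is the single term x, of
   weight 2. *)
rewrite wS; have [xT|xT] /= := boolP (x \in S `\ x); first lia.
have /eqP : S `\ x == mset0.
  apply/negPn/negP => /mset_neq0P [z zT].
  have /xE xz : z \in S by rewrite -SE in_mset1D zT orbT.
  by rewrite -xz (negPf xT) in zT.
move=> T0; move: ltS; rewrite T0 weight0 /nsums subsums0_mset0 cards1; lia.
Qed.

(** * Subset sums forming an arithmetic progression *)

Definition progression g n : {set G} := [set g *+ i | i : 'I_n.+1].

Lemma progressionP g n y :
  reflect (exists2 i, (i <= n)%N & y = g *+ i) (y \in progression g n).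
Proof.
apply: (iffP imsetP) => [[i _ ->]|[i ilen ->]]; first by exists i => //; rewrite -ltnS.
by exists (Ordinal (ilen : (i < n.+1)%N)).
Qed.

Lemma card_progression_leq g n : (#|progression g n| <= n.+1)%N.
Proof. by rewrite (leq_trans (leq_imset_card _ _)) // card_ord. Qed.

(** Together with the lower bound on |B(S)|, this yields the order conditions in forms (1) and
    (3). *)
Lemma card_progression_order g n : (#|progression g n| <= #[g]%g)%N.
Proof.
apply/subset_leq_card/subsetP => y /progressionP [i _ ->].
by rewrite -zmodXgE mem_cycle.
Qed.

Lemma subsums0_msetn n g : subsums0 (msetn n g) = progression g n.
Proof.
elim: n => [|n IHn].
  rewrite msetn0 subsums0_mset0; apply/setP=> y; rewrite inE.
  apply/eqP/progressionP => [->|[i]]; first by exists 0%N.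
  by rewrite leqn0 => /eqP -> ->.
have -> : msetn n.+1 g = g +` msetn n g.
  by apply/msetP=> a; rewrite mset1DE !msetnE; case: eqP.
apply/setP=> y; rewrite in_subsums0_mset1D IHn.
apply/orP/progressionP => [[/progressionP [i le_in ->]|/progressionP [i le_in]]|].
- by exists i; rewrite // ltnW.
- by move/eqP; rewrite subr_eq => /eqP ->; exists i.+1; rewrite // mulrSr.
case=> -[_ ->|i le_in ->]; first by left; apply/progressionP; exists 0%N.
by right; apply/progressionP; exists i; rewrite // mulrSr addrK.
Qed.

Lemma subsums0_msetn_double n g : (0 < n)%N ->
  subsums0 (msetn n g `+` [mset g *+ 2]) = progression g (n + 2).
Proof.
move=> n0; apply/setP=> y; rewrite msetDC in_subsums0_mset1D subsums0_msetn.
apply/orP/progressionP => [[/progressionP [i le_in ->]|/progressionP [i le_in]]|].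
- by exists i; rewrite // (leq_trans le_in) ?leq_addr.
- by move/eqP; rewrite subr_eq => /eqP ->; exists (i + 2)%N; rewrite ?leq_add2r // mulrnDr.
case=> i le_in ->; have [lt_in|lt_ni] := leqP i n.
  by left; apply/progressionP; exists i.
(* Here 0 < n < i, so i is at least 2 and the truncated subtraction is exact. *)
right; apply/progressionP; exists (i - 2)%N; first by rewrite leq_subLR addnC.
by rewrite mulrnBr //; lia.
Qed.

(** The new sums are the last three terms of the shifted progression x + B(S). *)
Lemma progression_gain3 x g n S :
    zero_sum_free (x +` S) -> subsums0 S = progression g n -> (2 <= n)%N ->
    (2 < #[g]%g)%N -> x != g -> x != g *+ 2 ->
  (nsums S + 3 <= nsums (x +` S))%N.
Proof.
rewrite zero_sum_free_mset1D => /andP [_ xS] SE n2 og xg x2g.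
have gn0 k : (0 < k < 3)%N -> g *+ k != 0.
  move=> k3; rewrite -zmodXgE -[0]/(1%g) -order_dvdn gtnNdvd //; lia.
pose f i := x + g *+ (n - i).
have new i : (i < 3)%N -> (f i \notin subsums0 S) && (f i - x \in subsums0 S).
  move=> i3; rewrite /f addrAC addrN add0r SE; apply/andP; split; last first.
    by apply/progressionP; exists (n - i)%N; rewrite ?leq_subr.
  apply/progressionP => -[t tn /eqP].
  (* Suppose x + (n - i)g = tg. If t <= n - i, then -x is a multiple of g in B(S); otherwise x = (t
     - (n - i))g with coefficient 1 or 2, both excluded. *)
  have [ti|it] := leqP t (n - i).
    have -> : g *+ (n - i) = g *+ (n - i - t) + g *+ t by rewrite -mulrnDr subnK.
    rewrite addrA -subr_eq0 addrK addrC addr_eq0 => /eqP gx.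
    by case/negP: xS; rewrite SE -gx; apply/progressionP; exists (n - i - t)%N => //; lia.
  rewrite -(subnK (ltnW it)) mulrnDr => /eqP /addIr xE.
  have : (t - (n - i) == 1)%N || (t - (n - i) == 2)%N by lia.
  by case/orP=> /eqP k; move: xg x2g; rewrite xE k ?mulr1n eqxx.
have fneq i j : (i < j < 3)%N -> f i != f j.
  move=> ij; rewrite /f (inj_eq (addrI x)).
  have -> : (n - i = (j - i) + (n - j))%N by lia.
  by rewrite mulrnDr -subr_eq0 addrK gn0 //; lia.
apply: (@card_subsums0_uniq x S [:: f 0%N; f 1%N; f 2%N]).
  by rewrite /= !inE !negb_or !fneq.
by move=> y; rewrite !(in_cons, in_nil) orbF => /or3P [] /eqP ->; apply: new.
Qed.

(** * Subset sums of sequences with one, two or three terms *)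

Lemma subsums0_mset1 x : subsums0 [mset x] =i [:: 0; x].
Proof.
move=> y; rewrite -[X in subsums0 X]msetD0 in_subsums0_mset1D subsums0_mset0.
by rewrite !inE subr_eq0.
Qed.

Lemma zero_sum_free_mset1 x : zero_sum_free [mset x] = (x != 0).
Proof.
rewrite -[[mset x]]msetD0 zero_sum_free_mset1D subsums0_mset0 in_set1 oppr_eq0.
suff -> : zero_sum_free (mset0 : {mset G}) by [].
by apply/zero_sum_freeP => T; rewrite msubset0 => /eqP.
Qed.

Lemma subsums0_mset2 x y : subsums0 (x +` [mset y]) =i [:: 0; x; y; x + y].
Proof.
move=> a; rewrite in_subsums0_mset1D !subsums0_mset1 !inE !subr_eq add0r.
by rewrite (addrC y); do !case: eqP.
Qed.

(** The eight subsequences give six expressions, since y + (x + y) = x and the single term x + y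
    equals the sum of x and y. *)
Lemma subsums0_mset3 x y : y *+ 2 = 0 ->
  subsums0 [mset x; y; x + y] =i
    [:: 0; x; y; x + y; x *+ 2; x *+ 2 + y].
Proof.
move=> y2 a; rewrite msetDC in_subsums0_mset1D !subsums0_mset2 !inE !subr_eq add0r.
have -> : y + (x + y) = x by rewrite addrCA -mulr2n y2 addr0.
have -> : x + y + (x + y) = x *+ 2 by rewrite addrACA -!mulr2n y2 addr0.
rewrite addrA -mulr2n.
case: (a == 0); case: (a == x); case: (a == y); case: (a == x + y) => //=.
by rewrite orbC.
Qed.

(** * The four extremal forms and their recognition *)

Definition extremal S :=
  [\/ exists g : G,
        [/\ g != 0, S = msetn (size S) g & (size S + 1 <= #[g]%g)%N],
      exists g1 g2 : G,
        [/\ g1 != 0, g2 != 0, g1 != g2 & S = [mset g1; g2]],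
      exists g : G,
        [/\ g != 0, S = msetn (size S - 1)%N g `+` [mset g *+ 2],
            (3 <= size S)%N & (size S + 2 <= #[g]%g)%N]
    | exists g1 g2 : G,
        [/\ g1 != 0 /\ g2 != 0, S = [mset g1; g2; g1 + g2],
            g1 *+ 2 != 0, g2 *+ 2 = 0 & g1 *+ 2 + g2 != 0]].

(** In each form B(S) is covered by an explicit progression or list whose length is the weight; the
    reverse inequality is [weight_leq_subsums0]. *)
Lemma nsums_extremal S :
  S != mset0 -> extremal S -> (nsums S <= weight S)%N.
Proof.
rewrite -size_mset_eq0 /nsums -lt0n => S0.
case=> [[g [g0 -> _]]|[x [y [x0 y0 xy ->]]]|[g [g0 SE S3 _]]|[x [y [[x0 y0] -> x2 y2 xy]]]].
- by rewrite subsums0_msetn weight_msetn // card_progression_leq.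
- rewrite weight_mset1D weight_msetn // in_mset1 xy (eq_card (subsums0_mset2 x y)).
  exact: (card_size [:: 0; x; y; x + y]).
- have S1 : (0 < size S - 1)%N by rewrite subn_gt0 ltnW.
  rewrite {}SE; move: (size S - 1)%N S1 => n n0.
  rewrite subsums0_msetn_double // (leq_trans (card_progression_leq _ _)) //.
  rewrite msetDC weight_mset1D weight_msetn // in_msetn n0 /=.
  by rewrite mulr2n -subr_eq0 addrK g0 addn2 addSn addn2.
rewrite (eq_card (subsums0_mset3 x y2)) msetDC !weight_mset1D weight_msetn //.
have /negPf xyx : x + y != x by rewrite -subr_eq0 addrAC subrr add0r.
have /negPf xyy : x + y != y by rewrite -subr_eq0 addrK.
have /negPf xny : x != y by apply: contraNneq x2 => ->; rewrite y2.
rewrite in_mset1D !in_mset1 xyx xyy xny.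
exact: (card_size [:: 0; x; y; x + y; x *+ 2; x *+ 2 + y]).
Qed.

Lemma extremal_msetn S g :
  S != mset0 -> zero_sum_free S -> S = msetn (size S) g -> extremal S.
Proof.
move=> S0 zS Sg; apply: Or41; exists g.
have s0 : (0 < size S)%N by rewrite lt0n size_mset_eq0.
split=> //.
  apply: contraTneq zS => g0; have -> : S = g +` (S `\ g).
    by rewrite msetB1K // Sg msetn1.
  by rewrite zero_sum_free_mset1D g0 oppr0 mem0_subsums0 andbF.
have := weight_leq_subsums0 zS; rewrite /nsums {1 2}Sg weight_msetn // subsums0_msetn addn1.
by move=> /leq_trans; apply; apply: card_progression_order.
Qed.

Lemma extremal_msetn_double S g n : zero_sum_free S -> (2 <= n)%N ->
  S = g *+ 2 +` msetn n g -> extremal S.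
Proof.
move=> zS n2 Sg; apply: Or43; exists g.
have szS : size S = n.+1 by rewrite Sg size_mset1D size_msetn.
have g0 : g != 0.
  apply: contraTneq zS => g0; rewrite Sg zero_sum_free_mset1D g0 mul0rn oppr0.
  by rewrite mem0_subsums0 andbF.
split=> //; rewrite ?szS //; first by rewrite subn1 msetDC.
have := weight_leq_subsums0 zS; rewrite /nsums Sg weight_mset1D weight_msetn; last by lia.
rewrite in_msetn msetDC subsums0_msetn_double; last by lia.
rewrite -subr_eq0 mulr2n addrK (negPf g0) andbF addn2 addn2 => /leq_trans; apply.
exact: card_progression_order.
Qed.

(** The inequalities of form (4) exclude zero sums: 2x + y is the sum of x and x + y, and 2x is the
    sum of all three terms. *)
Lemma extremal_mset3 x y :
  zero_sum_free [mset x; y; x + y] -> y *+ 2 = 0 -> extremal [mset x; y; x + y].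
Proof.
rewrite msetDC 2!zero_sum_free_mset1D zero_sum_free_mset1 => /andP [/andP [y0]].
rewrite subsums0_mset1 subsums0_mset2 !inE !negb_or oppr_eq0 => /andP [x0 _].
case/and4P=> _ nx _ nxy y2.
apply: Or44; exists x, y; split=> //; first by rewrite msetDC.
  apply: contraNneq nxy => x2.
  by rewrite eq_sym -addr_eq0 addrACA -!mulr2n x2 y2 addr0.
by apply: contraNneq nx => xy2; rewrite eq_sym -addr_eq0 addrA -mulr2n xy2.
Qed.

(** * Extending an extremal sequence by one term *)

Lemma extremal_of_mset2 x y z :
    x != y -> zero_sum_free (z +` (x +` [mset y])) -> z \notin x +` [mset y] ->
    (nsums (z +` (x +` [mset y])) < nsums (x +` [mset y]) + 3)%N ->
  extremal (z +` (x +` [mset y])).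
Proof.
move=> xy zS zT gain; have sS := msum_notin_subsums0 zS; move: (zS) zT.
rewrite in_mset1D in_mset1 negb_or => {}zT /andP [zx zy]; move: zT.
rewrite 2!zero_sum_free_mset1D zero_sum_free_mset1 => /andP [/andP [y0]].
rewrite subsums0_mset1 subsums0_mset2 !inE !negb_or !eqr_oppLR oppr0 -!addr_eq0.
case/andP=> [x0 xy0] /and4P [z0 zx0 zy0 zxy0].
(* The full sum z + x + y is always new, so a gain below 3 allows at most one of z, z + x, z + y to
   be new. *)
have gap a b : a \in subsums0 (x +` [mset y]) -> b \in subsums0 (x +` [mset y]) ->
    a != b -> a != x + y -> b != x + y ->
    (z + a \in subsums0 (x +` [mset y])) || (z + b \in subsums0 (x +` [mset y])).
  move=> aT bT ab axy bxy; apply: contraLR gain; rewrite negb_or -leqNgt => /andP [za zb].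
  apply: (@card_subsums0_uniq z _ [:: z + a; z + b; z + (x + y)]).
    by rewrite /= !inE !(inj_eq (addrI z)) negb_or ab axy bxy.
  move=> w; rewrite !(in_cons, in_nil) orbF => /or3P [] /eqP ->; rewrite (addrAC z _ (- z)) subrr add0r.
  - by rewrite za.
  - by rewrite zb.
  move: sS; rewrite !msumD !msum1 => -> /=.
  by rewrite subsums0_mset2 !inE eqxx !orbT.
(* Each of the three sums can be old in one way only; any other coincidence gives a zero sum or
   makes z equal to x or y. *)
have mem0 : (z + 0 \in subsums0 (x +` [mset y])) = (z == x + y).
  by rewrite subsums0_mset2 !inE addr0 (negPf z0) (negPf zx) (negPf zy).
have memx : (z + x \in subsums0 (x +` [mset y])) = (z + x == y).
  rewrite subsums0_mset2 !inE (negPf zx0) -subr_eq0 addrK (negPf z0) /=.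
  by rewrite [x + y]addrC (inj_eq (addIr x)) (negPf zy) orbF.
have memy : (z + y \in subsums0 (x +` [mset y])) = (z + y == x).
  rewrite subsums0_mset2 !inE (negPf zy0) (inj_eq (addIr y)) (negPf zx) orbF.
  by rewrite -[_ == y]subr_eq0 addrK (negPf z0) orbF.
have neqx : x != x + y by rewrite eq_sym -subr_eq0 addrAC subrr add0r.
have neqy : y != x + y by rewrite eq_sym -subr_eq0 addrK.
have g0x := gap 0 x; have g0y := gap 0 y; have gxy := gap x y.
rewrite mem0 memx memy !subsums0_mset2 !inE !eqxx !orbT in g0x g0y gxy.
rewrite ![0 == _]eq_sym in g0x g0y.
have {}g0x := g0x isT isT x0 xy0 neqx.
have {}g0y := g0y isT isT y0 xy0 neqy.
have {}gxy := gxy isT isT xy neqx neqy.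
(* If z = x + y, a second coincidence gives 2x = 0 or 2y = 0. Otherwise z + x = y and z + y = x,
   hence 2z = 0 and the sequence consists of x, z and x + z. *)
have [/eqP zE|zE] := boolP (z == x + y).
  case/orP: gxy => /eqP; rewrite {1}zE.
    rewrite addrAC -mulr2n => /eqP; rewrite -subr_eq0 addrK => /eqP x2.
    have SE : z +` (x +` [mset y]) = [mset y; x; y + x].
      by rewrite zE addrC msetDC (msetDC [mset x]).
    by rewrite SE in zS *; apply: extremal_mset3.
  rewrite -addrA -mulr2n => /eqP; rewrite -subr_eq0 addrAC subrr add0r => /eqP y2.
  have SE : z +` (x +` [mset y]) = [mset x; y; x + y] by rewrite zE msetDC.
  by rewrite SE in zS *; apply: extremal_mset3.
rewrite (negPf zE) /= in g0x g0y.
have yE : x + z = y by rewrite addrC (eqP g0x).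
have SE : z +` (x +` [mset y]) = [mset x; z; x + z] by rewrite yE -msetDA msetDCA.
rewrite SE in zS *; apply: extremal_mset3 => //.
move/eqP: g0y; rewrite -yE addrCA -mulr2n => /eqP.
by rewrite -subr_eq0 addrAC subrr add0r => /eqP.
Qed.

(** B is the union of the translates of {0, y} by 0, x and 2x, hence stable under adding y. The full
    sum z + 2x is new, so z + 2x + y is new as well; z + x is checked against the six sums. *)
Lemma mset3_gain3 x y z :
    x *+ 2 != 0 -> y *+ 2 = 0 -> y != 0 ->
    zero_sum_free (z +` [mset x; y; x + y]) -> z \notin [mset x; y; x + y] ->
  (nsums [mset x; y; (x + y)%R] + 3 <= nsums (z +` [mset x; y; (x + y)%R]))%N.
Proof.
move=> x2 y2 y0 zS; have := msum_notin_subsums0 zS; move: zS.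
rewrite zero_sum_free_mset1D => /andP [_].
rewrite !msumD !msum1 !in_msetD !in_mset1 !negb_or addrACA -!mulr2n y2 addr0.
set B := subsums0 _ => zB zx2 /andP [/andP [zx zy] zxy].
have BE : B =i [:: 0; x; y; x + y; x *+ 2; x *+ 2 + y] by apply: subsums0_mset3.
have Ny : - y = y by apply/eqP; rewrite eq_sym -addr_eq0 -mulr2n y2.
have x0 : x != 0 by apply: contraNneq x2 => ->; rewrite mul0rn.
have xy0 : x + y != 0 by rewrite addr_eq0 Ny; apply: contraNneq x2 => ->; rewrite y2.
have stable a : a \in B -> a + y \in B.
  rewrite !BE !inE => /or4P [|||/or3P []] /eqP ->.
  - by rewrite add0r eqxx !orbT.
  - by rewrite eqxx !orbT.
  - by rewrite -mulr2n y2 eqxx.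
  - by rewrite -addrA -mulr2n y2 addr0 eqxx !orbT.
  - by rewrite eqxx !orbT.
  by rewrite -addrA -mulr2n y2 addr0 eqxx !orbT.
apply: (@card_subsums0_uniq z _ [:: z + x; z + x *+ 2; z + (x *+ 2 + y)]).
  have addr_neq (a b : G) : b != 0 -> a != a + b.
    by move=> b0; rewrite eq_sym -subr_eq0 addrAC subrr add0r.
  by rewrite /= !inE !(inj_eq (addrI z)) negb_or mulr2n !addr_neq // -addrA addr_neq.
move=> w; rewrite !(in_cons, in_nil) orbF => /or3P [] /eqP ->; rewrite (addrAC z _ (- z)) subrr add0r -/B.
- rewrite !BE !inE eqxx orbT andbT !negb_or.
  move: zB; rewrite BE !inE !negb_or !eqr_oppLR oppr0 => /and4P [z0 nx ny /andP [nxy _]].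
  rewrite addr_eq0 nx -subr_eq0 addrK z0 /=.
  rewrite -[y in _ == y]Ny -addr_eq0 -addrA addr_eq0 nxy /=.
  rewrite [x + y]addrC (inj_eq (addIr x)) zy mulr2n (inj_eq (addIr x)) zx /=.
  by rewrite addrAC (inj_eq (addIr x)) zxy.
- by rewrite zx2 BE !inE eqxx !orbT.
apply/andP; split; last by rewrite BE !inE eqxx !orbT.
by apply: contra zx2 => /stable; rewrite -!addrA -mulr2n y2 addr0.
Qed.

(** * Classification by induction on the length *)

Lemma nsums_leq_weight_extremal S :
  S != mset0 -> zero_sum_free S -> (nsums S <= weight S)%N -> extremal S.
Proof.
elim: {S}(size S) {-2}S (erefl (size S)) => [|n IHn] S szS S0 zS leS.
  by rewrite -size_mset_eq0 szS in S0.
have [[g Sg]|[x [z [xS zS' xz]]]] := msetn_or_distinct S0.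
  exact: extremal_msetn Sg.
have [y [T [ST gain]]] := exists_gain2 zS xS zS' xz.
have {xS zS' xz} T0 : T != mset0.
  apply: contraNneq xz => T0; move: xS zS'.
  by rewrite ST T0 msetD0 !in_mset1 => /eqP -> /eqP ->.
move: szS zS leS gain; rewrite {S S0}ST size_mset1D weight_mset1D => -[szT] zS leS gain.
have /andP [zT yB] : zero_sum_free T && (- y \notin subsums0 T).
  by rewrite -zero_sum_free_mset1D.
(* The chain weight T + 2 <= |B(T)| + 2 <= |B(S)| <= weight S forces y outside T, a gain of exactly
   2 and equality for T. *)
have lowT := weight_leq_subsums0 zT; rewrite -/(nsums T) in lowT.
have yT : y \notin T by apply/negP => yT; move: leS; rewrite yT /=; lia.
rewrite yT /= in leS.
have nogain3 : ~ (nsums T + 3 <= nsums (y +` T))%N by lia.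
have leT : (nsums T <= weight T)%N by lia.
(* Form (1) extends to (2) when T has one term, and to (3) when y = 2g; form (2) extends to (4); in
   all remaining cases y would gain three sums. *)
case: (IHn T szT T0 zT leT) => [[g [g0 Tg og]]|[a [b [a0 b0 ab Tab]]]|[g [g0 Tg T3 og]]
  |[a [b [[a0 b0] Tab a2 b2 ab]]]].
- have yg : y != g by apply: contraNneq yT => ->; rewrite Tg msetn1 lt0n size_mset_eq0.
  have [T1|T2] := eqVneq (size T) 1%N.
    apply: Or42; exists y, g; split=> //; last by rewrite Tg T1.
    by apply: contraNneq yB => ->; rewrite oppr0 mem0_subsums0.
  have {}T2 : (2 <= size T)%N.
    by move: T0 T2; rewrite -size_mset_eq0; case: (size T) => [|[]].
  have [y2g|y2g] := eqVneq y (g *+ 2).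
    by apply: (@extremal_msetn_double _ g (size T)); rewrite // y2g {1}Tg.
  case: nogain3; apply: (@progression_gain3 _ g (size T)) => //.
    by rewrite {1}Tg subsums0_msetn.
  by apply: leq_trans og; rewrite addn1 ltnS.
- rewrite {}Tab in zS yT nogain3 *.
  by apply: extremal_of_mset2; rewrite // ltnNge; apply/negP.
- case: nogain3; apply: (@progression_gain3 _ g (size T - 1 + 2)) => //.
  + by rewrite {1}Tg subsums0_msetn_double // subn_gt0 ltnW.
  + by rewrite leq_addl.
  + by apply: leq_trans og; rewrite (leq_trans T3) ?leq_addr.
  + by apply: contraNneq yT => ->; rewrite Tg in_msetD msetn1 subn_gt0 ltnW.
  by apply: contraNneq yT => ->; rewrite Tg in_msetD in_mset1 eqxx orbT.
- by case: nogain3; rewrite Tab in zS yT *; apply: mset3_gain3.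
Qed.

End SubsetSums.

Theorem theorem1p4 (G : finZmodType) (S : {mset G}) :
  S != mset0 -> zero_sum_free S ->
  (#|subsums S| = size S + #|` finsupp S| - 1)%N <->
  [\/ exists g : G,
        [/\ g != 0, S = msetn (size S) g & (size S + 1 <= #[g]%g)%N],
      exists g1 g2 : G,
        [/\ g1 != 0, g2 != 0, g1 != g2 & S = [mset g1; g2]],
      exists g : G,
        [/\ g != 0, S = msetn (size S - 1)%N g `+` [mset g *+ 2],
            (3 <= size S)%N & (size S + 2 <= #[g]%g)%N]
    | exists g1 g2 : G,
        [/\ g1 != 0 /\ g2 != 0, S = [mset g1; g2; g1 + g2],
            g1 *+ 2 != 0, g2 *+ 2 = 0 & g1 *+ 2 + g2 != 0]].
Proof.
move=> S0 zS; have low := weight_leq_subsums0 zS; have card := card_subsums0 zS.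
(* Positivity makes the truncated [- 1] exact, so the equality becomes [nsums S = weight S]. *)
have w0 : (0 < weight S)%N by rewrite /weight ltn_addr // lt0n size_mset_eq0.
split=> [ES|exS].
  apply: nsums_leq_weight_extremal => //; rewrite card ES -/(weight S) subn1 prednK //.
have up := nsums_extremal S0 exS.
by rewrite -/(weight S); apply/eqP; rewrite -eqSS -card subn1 prednK // eqn_leq up.
Qed.
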